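(* Let $Y\in\mathbb{R}^{m\times n}$, let $\kappa>0$, and consider the regularized asymmetric matrix factorization objective $$f(W,H)=\frac12\|WH-Y\|_F^2+\frac{\kappa}{4}\|W\|_F^4+\frac{\kappa}{4}\|H\|_F^4,\qquad W\in\mathbb{R}^{m\times r},\ H\in\mathbb{R}^{r\times n}.$$ Then the following statements hold. (i) For any $L_1>0$ there exists an $L_0>0$ such that $f$ is $(L_0,L_1)$-smooth. (ii) If $\phi$ is a reference function on $\mathbb{R}^{mr+rn}$ satisfying conditions (S) and (I) given in the context, then for any $\bar L>0$ there exists an $L>0$ such that $f$ satisfies the second-order characterization of $(L,\bar L)$-anisotropic smoothness relative to $\phi$.
   Context: The variable $(W,H)$ is identified with the concatenation $x\in\mathbb{R}^N$, $N=mr+rn$, of the vectorizations of $W$ and $H$, so $\|x\|^2=\|W\|_F^2+\|H\|_F^2$. $\|\cdot\|$ is the Euclidean norm on vectors and the spectral norm on matrices (in particular on Hessians); $\|\cdot\|_F$ is the Frobenius norm; $\mathbb{R}_+=[0,\infty)$. A twice continuously differentiable $f:\mathbb{R}^N\to\mathbb{R}$ is $(L_0,L_1)$-smooth, with $L_0,L_1\ge0$, if $\|\nabla^2 f(x)\|\le L_0+L_1\|\nabla f(x)\|$ for all $x$. Standing assumption: a reference function is a function $\phi:\mathbb{R}^N\to\overline{\mathbb{R}}$ that is proper, lower semicontinuous, strongly convex and even, with $\phi(0)=0$; $\phi^*$ is its convex conjugate. $f$ satisfies the second-order characterization of $(L,\bar L)$-anisotropic smoothness relative to $\phi$ if $\lambda_{\max}(\nabla^2\phi^*(\bar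 L^{-1}\nabla f(x))\nabla^2 f(x))\le L\bar L$ for all $x\in\mathbb{R}^N$. Condition (S): $\operatorname{int}\operatorname{dom}\phi\ne\emptyset$; $\phi\in\mathcal{C}^2(\operatorname{int}\operatorname{dom}\phi)$; and for any sequence $(x^k)$ converging to some boundary point of $\operatorname{int}\operatorname{dom}\phi$, $\|\nabla\phi(x^k)\|\to\infty$. (This ensures in particular $\phi^*\in\mathcal{C}^2(\mathbb{R}^N)$.) Condition (I): $\phi$ is isotropic, i.e. $\phi(x)=h(\|x\|)$ for a scalar kernel function $h:\mathbb{R}\to\mathbb{R}_+\cup\{\infty\}$, and, with $h^*$ the convex conjugate of $h$: (i) ${h^*}'(y)/y$ is a decreasing function on $\mathbb{R}_+$; (ii) $\lim_{y\to+\infty}y\,{h^*}''(y)=C_2$ for some $C_2\in\mathbb{R}_+$; (iii) $\lim_{y\to+\infty}{h^*}'(s_d(y))/y=0$ for any polynomial $s_d(\alpha)=\sum_{i=0}^d u_i\alpha^i$ of degree $d$. *)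

(* Defs.v *)
From mathcomp Require Import all_boot all_order all_algebra.
From mathcomp Require Import all_classical all_reals all_analysis.
Import Order.TTheory GRing.Theory Num.Theory.
Import numFieldNormedType.Exports.

Set Implicit Arguments.
Unset Strict Implicit.
Unset Printing Implicit Defensive.

Local Open Scope classical_set_scope.
Local Open Scope ring_scope.

(* On row and column vectors this is the Euclidean norm.  The norm `|_| that
   the library puts on matrices is the sup norm; it is used here only for the
   topology and for differentiability, which do not depend on the norm. *)
Definition frob_norm {R : realType} {m n : nat} (A : 'M[R]_(m, n)) : R :=
  Num.sqrt (\sum_(i < m) \sum_(j < n) A i j ^+ 2).

Definition dot {R : realType} {N : nat} (x y : 'rV[R]_N) : R :=
  \sum_(i < N) x 0 i * y 0 i.

Definition spectral_norm {R : realType} {m n : nat} (A : 'M[R]_(m, n)) : R :=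
  sup [set frob_norm (A *m v) | v in [set v : 'cV[R]_n | frob_norm v <= 1]].

(* Largest real eigenvalue.  It is applied to products of a positive
   semidefinite and a symmetric matrix, whose eigenvalues are all real. *)
Definition lambda_max {R : realType} {N : nat} (A : 'M[R]_N) : R :=
  sup [set a : R | eigenvalue A a].

Definition gradient {R : realType} {N : nat} (f : 'rV[R]_N -> R)
    (x : 'rV[R]_N) : 'rV[R]_N :=
  \row_(i < N) 'D_(delta_mx 0 i) f x.

Definition hessian {R : realType} {N : nat} (f : 'rV[R]_N -> R)
    (x : 'rV[R]_N) : 'M[R]_N :=
  'J (gradient f) x.

(* Meant for open U. *)
Definition C2_on {R : realType} {N : nat} (U : set 'rV[R]_N)
    (f : 'rV[R]_N -> R) : Prop :=
  forall x, U x ->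
    [/\ differentiable f x, differentiable (gradient f) x
      & {for x, continuous (hessian f)}].

Definition L0L1_smooth {R : realType} {N : nat} (L0 L1 : R)
    (f : 'rV[R]_N -> R) : Prop :=
  [/\ 0 <= L0, 0 <= L1, C2_on setT f
    & forall x, spectral_norm (hessian f x)
                <= L0 + L1 * frob_norm (gradient f x)].

Definition edom {R : realType} {T : Type} (phi : T -> \bar R) : set T :=
  [set x | (phi x < +oo)%E].

Definition proper_fun {R : realType} {T : Type} (phi : T -> \bar R) : Prop :=
  (forall x, phi x != -oo%E) /\ edom phi !=set0.

Definition strongly_convex {R : realType} {N : nat}
    (phi : 'rV[R]_N -> \bar R) : Prop :=
  exists2 mu : R, 0 < mu &
    forall (x y : 'rV[R]_N) (t : R), 0 < t -> t < 1 ->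
      (phi (t *: x + (1 - t) *: y)%R
         + (mu / 2 * t * (1 - t) * frob_norm (x - y) ^+ 2)%:E
       <= t%:E * phi x + (1 - t)%:E * phi y)%E.

Definition reference_function {R : realType} {N : nat}
    (phi : 'rV[R]_N -> \bar R) : Prop :=
  [/\ proper_fun phi, lower_semicontinuous phi, strongly_convex phi,
      (forall x, phi (- x) = phi x) & phi 0 = 0%E].

(* Convex conjugate with respect to the inner product ip. *)
Definition conjugate {R : realType} {T : Type} (ip : T -> T -> R)
    (phi : T -> \bar R) (y : T) : \bar R :=
  ereal_sup [set ((ip x y)%:E - phi x)%E | x in setT].

Definition vconj {R : realType} {N : nat} (phi : 'rV[R]_N -> \bar R)
    (y : 'rV[R]_N) : R :=
  fine (conjugate dot phi y).

Definition sconj {R : realType} (h : R -> \bar R) (y : R) : R :=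
  fine (conjugate *%R h y).

Definition anisotropic_smooth2 {R : realType} {N : nat} (L Lbar : R)
    (phi : 'rV[R]_N -> \bar R) (f : 'rV[R]_N -> R) : Prop :=
  forall x, lambda_max (hessian (vconj phi) (Lbar^-1 *: gradient f x)
                        *m hessian f x) <= L * Lbar.

Definition boundary {T : topologicalType} (A : set T) : set T :=
  closure A `\` A°.

Definition condS {R : realType} {N : nat} (phi : 'rV[R]_N -> \bar R) : Prop :=
  [/\ (edom phi)° !=set0,
      C2_on (edom phi)° (fine \o phi)
    & forall (x : nat -> 'rV[R]_N) (p : 'rV[R]_N),
        (forall k, (edom phi)° (x k)) ->
        boundary (edom phi)° p ->
        x k @[k --> \oo] --> p ->
        frob_norm (gradient (fine \o phi) (x k)) @[k --> \oo] --> +oo].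

(* The quotient h^*'(y) / y is undefined at y = 0, so its monotonicity is only
   required for y > 0; "decreasing" is understood in the wide sense. *)
Definition condI {R : realType} {N : nat} (phi : 'rV[R]_N -> \bar R) : Prop :=
  exists h : R -> \bar R,
    [/\ (forall t, (0 <= h t)%E),
        (forall x, phi x = h (frob_norm x)),
        (forall y z : R, 0 < y -> y <= z ->
           ((sconj h)^`())%classic z / z <= ((sconj h)^`())%classic y / y),
        (exists2 C2 : R, 0 <= C2 &
           y * ((sconj h)^`(2))%classic y @[y --> +oo] --> C2)
      & forall s : {poly R},
          ((sconj h)^`())%classic s.[y] / y @[y --> +oo] --> (0 : R)].

Definition mf_objective {R : realType} {m n r : nat} (Y : 'M[R]_(m, n))
    (kappa : R) (W : 'M[R]_(m, r)) (H : 'M[R]_(r, n)) : R :=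
  1 / 2 * frob_norm (W *m H - Y) ^+ 2
  + kappa / 4 * frob_norm W ^+ 4 + kappa / 4 * frob_norm H ^+ 4.

(* The objective in the variable x = (vec W, vec H). *)
Definition mf_objective_vec {R : realType} {m n : nat} (r : nat)
    (Y : 'M[R]_(m, n)) (kappa : R) (x : 'rV[R]_(m * r + r * n)) : R :=
  mf_objective Y kappa (vec_mx (lsubmx x)) (vec_mx (rsubmx x)).

Arguments mf_objective_vec {R m n} r Y kappa x.

(* Main.v *)
Require Import Defs.
From mathcomp Require Import all_boot all_order all_algebra.
From mathcomp Require Import all_classical all_reals all_analysis.
From mathcomp Require Import ring lra.
Import Order.TTheory GRing.Theory Num.Theory.
Import numFieldNormedType.Exports.
Set Implicit Arguments.
Unset Strict Implicit.
Unset Printing Implicit Defensive.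
Local Open Scope classical_set_scope.
Local Open Scope ring_scope.

(** Write [|.|] for [frob_norm] and [f] for the objective.  Two facts about [f]
    carry both parts.  As [f] is a polynomial of degree 4, its Hessian grows at
    most quadratically ([polyfun_hessian_growth]).  As the regularizer is
    quartic, pairing the gradient with [x] gives
    [|gradient f x| >= kappa / 4 * |x|^3] for large [x]
    ([gradient_mf_objective_ge]).  Hence [L1 * |gradient f x|] overtakes the
    Hessian outside a ball, whatever [L1 > 0] is, and [L0] only has to cover
    that ball.

    For the anisotropic bound, let [phi* = vconj phi], [psi = sconj h] and
    [a t = psi' t / t].  Strong convexity of [phi] bounds the second differences
    of the convex function [phi*], so [phi*] is differentiable, and isotropy
    gives [phi* y = psi |y|] and [gradient phi* y = a |y| *: y]
    ([gradient_vconj]).  The factor [a] is nonincreasing by assumption, whereas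
    [t |-> a t * t = psi' t] is nondecreasing by convexity; a planar computation
    then shows that [gradient phi*] is Lipschitz with constant [a rho] outside
    the ball of radius [rho] ([gradient_vconj_lipschitz]).  The Hessian of
    [phi*] inherits the bound: its norm at [y] is at most [a (|y| / 2)], and
    strong convexity gives [a <= 2 / mu] throughout.

    An eigenvalue of a product of matrices is at most the product of their
    norms.  On bounded sets both Hessians are bounded.  For large [x] the point
    [y = Lbar^-1 *: gradient f x] satisfies [|y| / 2 >= c * |x|^3] for some
    [c > 0], and [psi' (c * t^3) / t --> 0] makes [a (c * |x|^3)] smaller than
    [(c * |x|^2)^-1], which cancels the quadratic growth of the Hessian of
    [f]. *)

(** * Euclidean geometry of the Frobenius norm *)

(** With [P], [A], [S] the three sums, [\sum_i (S * a i - P * b i) ^+ 2] equals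
    [S * (A * S - P ^+ 2)] and is nonnegative. *)
Lemma sum_cauchy_schwarz (R : realFieldType) (I : finType) (a b : I -> R) :
  (\sum_i a i * b i) ^+ 2 <= (\sum_i a i ^+ 2) * (\sum_i b i ^+ 2).
Proof.
set P := \sum_i a i * b i; set A := \sum_i a i ^+ 2; set S := \sum_i b i ^+ 2.
have S0 : 0 <= S by apply: sumr_ge0 => i _; exact: sqr_ge0.
have : 0 <= \sum_i (S * a i - P * b i) ^+ 2.
  by apply: sumr_ge0 => i _; exact: sqr_ge0.
have -> : \sum_i (S * a i - P * b i) ^+ 2 = S * (A * S - P ^+ 2).
  have sqE p s x y : (s * x - p * y) ^+ 2 =
      s ^+ 2 * x ^+ 2 - (2 * s * p) * (x * y) + p ^+ 2 * y ^+ 2 :> R by ring.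
  under eq_bigr do rewrite sqE.
  rewrite big_split sumrB -!mulr_sumr -/P -/A -/S/=.
  by clear S0; move: P A S => P A S; ring.
have [S00|Sn0] := eqVneq S 0.
  have b0 i : b i = 0.
    have /eqP := S00; rewrite /S psumr_eq0 => [/allP/(_ i)|j _]; last exact: sqr_ge0.
    by rewrite mem_index_enum sqrf_eq0 => /(_ isT)/eqP.
  by move=> _; rewrite S00 mulr0 /P big1 ?expr0n// => i _; rewrite b0 mulr0.
by rewrite pmulr_rge0 ?lt0r ?Sn0// subr_ge0.
Qed.

Section frobenius_norm.
Context {R : realType}.

Lemma frob_norm_ge0 m n (A : 'M[R]_(m, n)) : 0 <= frob_norm A.
Proof. exact: sqrtr_ge0. Qed.

Lemma sqr_frob_norm m n (A : 'M[R]_(m, n)) :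
  frob_norm A ^+ 2 = \sum_i \sum_j A i j ^+ 2.
Proof.
by rewrite sqr_sqrtr// !sumr_ge0// => i _; rewrite sumr_ge0// => j _; rewrite sqr_ge0.
Qed.

Lemma frob_norm0 m n : frob_norm (0 : 'M[R]_(m, n)) = 0.
Proof.
apply/eqP; rewrite -sqrf_eq0 sqr_frob_norm big1// => i _.
by rewrite big1// => j _; rewrite mxE expr0n.
Qed.

Lemma frob_norm_eq0 m n (A : 'M[R]_(m, n)) : frob_norm A = 0 -> A = 0.
Proof.
move=> A0; have : \sum_i \sum_j A i j ^+ 2 = 0 by rewrite -sqr_frob_norm A0 expr0n.
have ge0 i : 0 <= \sum_j A i j ^+ 2 by rewrite sumr_ge0// => j _; rewrite sqr_ge0.
move/eqP; rewrite psumr_eq0// => /allP Ai0; apply/matrixP => i j.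
have := Ai0 i; rewrite mem_index_enum => /(_ isT)/=.
rewrite psumr_eq0 => [/allP/(_ j)|k _]; last exact: sqr_ge0.
by rewrite mem_index_enum => /(_ isT)/=; rewrite sqrf_eq0 mxE => /eqP.
Qed.

Lemma frob_norm_gt0 m n (A : 'M[R]_(m, n)) : A != 0 -> 0 < frob_norm A.
Proof.
move=> A0; rewrite lt0r frob_norm_ge0 andbT; apply: contra_neq A0.
exact: frob_norm_eq0.
Qed.

Lemma frob_normZ m n (k : R) (A : 'M[R]_(m, n)) :
  frob_norm (k *: A) = `|k| * frob_norm A.
Proof.
apply/eqP; rewrite -(@eqrXn2 _ 2)// ?frob_norm_ge0 ?mulr_ge0 ?frob_norm_ge0//.
rewrite exprMn !sqr_frob_norm real_normK ?num_real// mulr_sumr.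
apply/eqP/eq_bigr => i _; rewrite mulr_sumr; apply: eq_bigr => j _.
by rewrite mxE exprMn.
Qed.

Lemma le_frob_norm m n (A : 'M[R]_(m, n)) (k : R) :
  0 <= k -> frob_norm A ^+ 2 <= k ^+ 2 -> frob_norm A <= k.
Proof. by move=> k0; rewrite ler_sqr ?nnegrE ?frob_norm_ge0. Qed.

Lemma norm_entry_le m n (A : 'M[R]_(m, n)) i j : `|A i j| <= frob_norm A.
Proof.
rewrite -ler_sqr ?nnegrE ?frob_norm_ge0// real_normK ?num_real// sqr_frob_norm.
rewrite (bigD1 i)//= (bigD1 j)//= -addrA lerDl addr_ge0// sumr_ge0// => k _.
  exact: sqr_ge0.
by rewrite sumr_ge0// => l _; rewrite sqr_ge0.
Qed.

Lemma frob_norm_mulmx m n p (A : 'M[R]_(m, n)) (B : 'M[R]_(n, p)) :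
  frob_norm (A *m B) <= frob_norm A * frob_norm B.
Proof.
apply: le_frob_norm; first by rewrite mulr_ge0 ?frob_norm_ge0.
rewrite exprMn !sqr_frob_norm mulr_suml; apply: ler_sum => i _.
rewrite exchange_big mulr_sumr; apply: ler_sum => j _.
by rewrite mxE; exact: sum_cauchy_schwarz.
Qed.

Lemma frob_norm_continuous m n : continuous (@frob_norm R m n).
Proof.
have cont : continuous (fun A : 'M[R]_(m, n) => \sum_i \sum_j A i j ^+ 2).
  apply: continuous_big => [|i _]; first exact: add_continuous.
  apply: continuous_big => [|j _ B]; first exact: add_continuous.
  apply: (@continuous_comp _ _ _ (fun C : 'M[R]_(m, n) => C i j) (fun t => t ^+ 2)).
    exact: coord_continuous.
  exact: exprn_continuous.
move=> A; apply: (@continuous_comp _ _ _ _ Num.sqrt); first exact: cont.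
exact: sqrt_continuous.
Qed.

Lemma frob_norm_le_entries m n (A : 'M[R]_(m, n)) (k : R) : 0 <= k ->
  (forall i j, `|A i j| <= k) -> frob_norm A <= Num.sqrt (m * n)%:R * k.
Proof.
move=> k0 Ak; apply: le_frob_norm; first by rewrite mulr_ge0 ?sqrtr_ge0.
rewrite sqr_frob_norm exprMn sqr_sqrtr ?ler0n//.
apply: (@le_trans _ _ (\sum_(i < m) \sum_(j < n) k ^+ 2)).
  apply: ler_sum => i _; apply: ler_sum => j _.
  by rewrite -real_normK ?num_real// ler_sqr ?nnegrE.
by rewrite !sumr_const !card_ord -mulrnA mulnC mulr_natl.
Qed.

Lemma dotC N (x y : 'rV[R]_N) : dot x y = dot y x.
Proof. by apply: eq_bigr => i _; rewrite mulrC. Qed.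

Lemma dotDl N (x y z : 'rV[R]_N) : dot (x + y) z = dot x z + dot y z.
Proof. by rewrite -big_split; apply: eq_bigr => i _; rewrite mxE mulrDl. Qed.

Lemma dotZl N k (x z : 'rV[R]_N) : dot (k *: x) z = k * dot x z.
Proof. by rewrite mulr_sumr; apply: eq_bigr => i _; rewrite mxE mulrA. Qed.

Lemma dotNl N (x z : 'rV[R]_N) : dot (- x) z = - dot x z.
Proof. by rewrite -scaleN1r dotZl mulN1r. Qed.

Lemma dotDr N (x y z : 'rV[R]_N) : dot z (x + y) = dot z x + dot z y.
Proof. by rewrite !(dotC z) dotDl. Qed.

Lemma dotZr N k (x z : 'rV[R]_N) : dot z (k *: x) = k * dot z x.
Proof. by rewrite !(dotC z) dotZl. Qed.

Lemma dotNr N (x z : 'rV[R]_N) : dot z (- x) = - dot z x.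
Proof. by rewrite !(dotC z) dotNl. Qed.

Lemma dot0r N (x : 'rV[R]_N) : dot x 0 = 0.
Proof. by rewrite -(scale0r 0) dotZr mul0r. Qed.

Lemma dotxx N (x : 'rV[R]_N) : dot x x = frob_norm x ^+ 2.
Proof. by rewrite sqr_frob_norm big_ord1; apply: eq_bigr => i _; rewrite expr2. Qed.

Lemma norm_dot_le N (x y : 'rV[R]_N) : `|dot x y| <= frob_norm x * frob_norm y.
Proof.
rewrite -ler_sqr ?nnegrE ?mulr_ge0 ?frob_norm_ge0//.
rewrite real_normK ?num_real// exprMn !sqr_frob_norm !big_ord1.
exact: sum_cauchy_schwarz.
Qed.

Lemma dot_le N (x y : 'rV[R]_N) : dot x y <= frob_norm x * frob_norm y.
Proof. exact: le_trans (ler_norm _) (norm_dot_le _ _). Qed.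

End frobenius_norm.

(** * Derivatives from quadratic and Lipschitz bounds *)

Section derivatives.
Context {R : realType}.

(** A quadratic remainder identifies the derivative without any appeal to the
    chain rule: the conjugates are differentiated through their convexity
    inequalities, and the objective along a ray through its expansion. *)
Lemma is_derive_quadratic (V : normedModType R) (F : V -> R) (y v : V) (l K : R) :
  (\forall s \near (0 : R)^', `|F (s *: v + y) - F y - s * l| <= K * s ^+ 2) ->
  is_derive y v F l.
Proof.
move=> FK.
suff Fl : h^-1 *: (F (h *: v + y) - F y) @[h --> 0^'] --> l.
  by split; [apply/cvg_ex; exists l | exact: cvg_lim Fl].
apply/cvgrPdist_le => e e0.
have K0 : 0 < `|K| + 1 by rewrite ltr_wpDl.
near=> s.
have s0 : s != 0 by near: s; exact: nbhs_dnbhs_neq.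
have sn0 : 0 < `|s| by rewrite normr_gt0.
have -> : l - s^-1 *: (F (s *: v + y) - F y) =
    - (s^-1 * (F (s *: v + y) - F y - s * l)).
  by rewrite /GRing.scale/=; field.
rewrite normrN normrM normfV ler_pdivrMl//.
apply: (@le_trans _ _ (K * s ^+ 2)); first by near: s.
rewrite -real_normK ?num_real// expr2 mulrCA ler_pM2l//.
apply: (@le_trans _ _ ((`|K| + 1) * `|s|)).
  by rewrite ler_pM2r// (le_trans (ler_norm K))// lerDl.
rewrite -ler_pdivlMl//; near: s.
by apply: dnbhs0_le; rewrite mulr_gt0// invr_gt0.
Unshelve. all: by end_near. Qed.

Lemma gradient_quadratic N (F : 'rV[R]_N -> R) (y p : 'rV[R]_N) (K : R) :
  (forall v, `|F (y + v) - F y - dot p v| <= K * frob_norm v ^+ 2) ->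
  gradient F y = p.
Proof.
move=> FK; apply/rowP => i; rewrite mxE.
have dp : dot p (delta_mx 0 i) = p 0 i.
  rewrite /dot (bigD1 i)//= big1 => [|j ji]; rewrite mxE !eqxx/= ?mulr1 ?addr0//.
  by rewrite (negbTE ji) mulr0.
suff /@derive_val -> : is_derive y (delta_mx 0 i) F (dot p (delta_mx 0 i)) by [].
apply: (@is_derive_quadratic _ _ _ _ _ (K * frob_norm (delta_mx 0 i : 'rV[R]_N) ^+ 2)).
near=> s; rewrite [_ + y]addrC -dotZr (le_trans (FK _))//.
by rewrite frob_normZ exprMn real_normK ?num_real// -mulrA (mulrC (_ ^+ 2)).
Unshelve. all: by end_near. Qed.

(** A Lipschitz bound on the gradient is inherited by the Hessian: where the
    gradient is differentiable, by passing to the limit in the difference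
    quotients; elsewhere ['d] is the zero map. *)
Lemma frob_norm_mul_hessian_le N (F : 'rV[R]_N -> R) (y v : 'rV[R]_N) (K : R) :
  0 <= K ->
  (\forall s \near (0 : R)^', frob_norm (gradient F (s *: v + y) - gradient F y)
     <= K * (`|s| * frob_norm v)) ->
  frob_norm (v *m hessian F y) <= K * frob_norm v.
Proof.
move=> K0 GK; have [dG|ndG] := pselect (differentiable (gradient F) y); last first.
  rewrite /hessian /jacobian mul_rV_lin1 (_ : 'd _ _ v = 0).
    by rewrite frob_norm0 mulr_ge0 ?frob_norm_ge0.
  rewrite /diff getPN// => df dfP; apply: ndG.
  by apply/diffP; rewrite /diff; exact: (@getPex _ (fun df => _ /\ _) (ex_intro _ df dfP)).
rewrite /hessian -deriveEjacobian//.
have /cvg_ex[l Gl] : derivable (gradient F) y v by exact: diff_derivable.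
have -> : 'D_v (gradient F) y = l by exact: cvg_lim Gl.
apply: (@closed_cvg _ _ (0 : R)^' _ _ [set A | frob_norm A <= K * frob_norm v] _ _ l Gl).
  apply: (@closed_comp _ _ (@frob_norm R 1 N) [set t | t <= K * frob_norm v]).
    by move=> A _; exact: frob_norm_continuous.
  exact: closed_le.
near=> s.
have s0 : s != 0 by near: s; exact: nbhs_dnbhs_neq.
rewrite /= frob_normZ normfV ler_pdivrMl ?normr_gt0// mulrCA.
by near: s.
Unshelve. all: by end_near. Qed.

End derivatives.

(** * Convex conjugates *)

Section conjugates.
Context {R : realType}.

(** The conjugate of a proper function is the least upper bound, in the reals,
    of the affine functions attached to the points of the effective domain, as
    soon as these are bounded; [fine] then loses no information. *)
Lemma fine_conjugate (T : Type) (ip : T -> T -> R) (phi : T -> \bar R)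
    (y : T) (B : R) :
  proper_fun phi ->
  (forall x r, phi x = r%:E -> ip x y - r <= B) ->
  (forall x r, phi x = r%:E -> ip x y - r <= fine (conjugate ip phi y)) /\
  (forall M, (forall x r, phi x = r%:E -> ip x y - r <= M) ->
     fine (conjugate ip phi y) <= M).
Proof.
move=> [phiNy [x0]] phix0 leB.
have [r0 phix0E] : exists r0, phi x0 = r0%:E.
  have := phiNy x0; move: phix0; rewrite /edom/=.
  by case: (phi x0) => [r0| |]// _ _; exists r0.
have ub M : (forall x r, phi x = r%:E -> ip x y - r <= M) ->
    (conjugate ip phi y <= M%:E)%E.
  move=> leM; apply: ge_ereal_sup => _ [x _ <-].
  have := phiNy x; case E : (phi x) => [r| |]// _; last by rewrite leNye.
  by rewrite -EFinB lee_fin; exact: leM.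
have lb x r : phi x = r%:E -> ((ip x y - r)%:E <= conjugate ip phi y)%E.
  by move=> E; apply: ereal_sup_ubound; exists x => //; rewrite E EFinB.
have fin : (conjugate ip phi y \is a fin_num)%E.
  rewrite fin_numElt (lt_le_trans _ (lb _ _ phix0E)) ?ltNyr//=.
  by rewrite (le_lt_trans (ub _ leB))// ltry.
by split=> [x r /lb|M /ub]; rewrite -{1}(fineK fin) lee_fin.
Qed.

End conjugates.

Section strongly_convex_conjugate.
Context {R : realType} {N : nat} (phi : 'rV[R]_N -> \bar R) (mu : R).
Context (mu_gt0 : 0 < mu) (phi_proper : proper_fun phi) (phi0 : phi 0 = 0%E).
Context (phi_even : forall x, phi (- x) = phi x).
Context (phi_sc : forall (x y : 'rV[R]_N) (t : R), 0 < t -> t < 1 ->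
  (phi (t *: x + (1 - t) *: y)%R
     + (mu / 2 * t * (1 - t) * frob_norm (x - y) ^+ 2)%:E
   <= t%:E * phi x + (1 - t)%:E * phi y)%E).

(** The strong convexity inequality at [t = 1 / 2], between points of the effective
    domain, where it can be written in the reals. *)
Lemma strongly_convex_midpoint x y r s : phi x = r%:E -> phi y = s%:E ->
  exists2 q, phi (2^-1 *: (x + y)) = q%:E &
    q + mu / 8 * frob_norm (x - y) ^+ 2 <= (r + s) / 2.
Proof.
move=> xE yE; have := @phi_sc x y 2^-1; rewrite xE yE.
have -> : 1 - 2^-1 = 2^-1 :> R by field.
rewrite -scalerDr invr_gt0 ltr0n invf_lt1// ltr1n => /(_ isT isT).
have := phi_proper.1 (2^-1 *: (x + y)).
case: (phi _) => [q| |]// _; rewrite -!EFinM -!EFinD lee_fin => qle.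
by exists q => //; lra.
Qed.

(** Evenness makes [0], where [phi] vanishes, the midpoint of two points with
    equal values. *)
Lemma strongly_convex_ge x r : phi x = r%:E -> mu / 2 * frob_norm x ^+ 2 <= r.
Proof.
move=> xE; have := phi_even x; rewrite xE => NxE.
have [q] := strongly_convex_midpoint xE NxE.
rewrite subrr scaler0 phi0 => -[<-].
have -> : x - - x = 2%:R *: x by rewrite opprK scaler_nat mulr2n.
rewrite frob_normZ exprMn real_normK ?num_real//; lra.
Qed.

Lemma dot_sub_le x y r : phi x = r%:E ->
  dot x y - r <= (2 * mu)^-1 * frob_norm y ^+ 2.
Proof.
move=> /strongly_convex_ge xge; have xy := dot_le x y.
have : 0 <= (2 * mu)^-1 * (frob_norm y - mu * frob_norm x) ^+ 2.
  by rewrite mulr_ge0 ?sqr_ge0// invr_ge0 mulr_ge0// ltW.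
have -> : (2 * mu)^-1 * (frob_norm y - mu * frob_norm x) ^+ 2 =
  (2 * mu)^-1 * frob_norm y ^+ 2 - frob_norm x * frob_norm y
    + mu / 2 * frob_norm x ^+ 2 by field; rewrite gt_eqF.
lra.
Qed.

Lemma vconj_ge x y r : phi x = r%:E -> dot x y - r <= vconj phi y.
Proof.
by move: x r; apply: (fine_conjugate phi_proper (fun x r => @dot_sub_le x y r)).1.
Qed.

Lemma vconj_le y M : (forall x r, phi x = r%:E -> dot x y - r <= M) ->
  vconj phi y <= M.
Proof. exact: (fine_conjugate phi_proper (fun x r => @dot_sub_le x y r)).2. Qed.

Lemma vconj_ge0 y : 0 <= vconj phi y.
Proof. by have := vconj_ge y phi0; rewrite dotC dot0r subr0. Qed.

Lemma vconj_le_sqr y : vconj phi y <= (2 * mu)^-1 * frob_norm y ^+ 2.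
Proof. by apply: vconj_le => x r; exact: dot_sub_le. Qed.

Lemma vconj_convex a b y z : 0 <= a -> 0 <= b -> a + b = 1 ->
  vconj phi (a *: y + b *: z) <= a * vconj phi y + b * vconj phi z.
Proof.
move=> a0 b0 ab1; apply: vconj_le => x r xE.
have := ler_wpM2l a0 (vconj_ge y xE); have := ler_wpM2l b0 (vconj_ge z xE).
rewrite dotDr !dotZr !mulrBr.
have : a * r + b * r = r by rewrite -mulrDl ab1 mul1r.
lra.
Qed.

(** Dual to strong convexity: a point [x1] competing in the supremum at [y + v]
    and [x2] at [y - v] are compared with their midpoint, which competes at [y];
    the gap [mu / 4 * |x1 - x2|^2] absorbs the cross term [<x1 - x2, v>]. *)
Lemma vconj_second_difference y v :
  vconj phi (y + v) + vconj phi (y - v) - 2 * vconj phi y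
    <= mu^-1 * frob_norm v ^+ 2.
Proof.
set M := 2 * vconj phi y + mu^-1 * frob_norm v ^+ 2.
suff : vconj phi (y + v) <= M - vconj phi (y - v) by rewrite /M; lra.
apply: vconj_le => x1 r1 x1E; rewrite lerBrDl -lerBrDr.
apply: vconj_le => x2 r2 x2E.
have [q /(vconj_ge y)] := strongly_convex_midpoint x1E x2E.
rewrite dotZl dotDl.
have := dot_le (x1 - x2) v; rewrite dotDl dotNl !dotDr !dotNr /M.
set d := frob_norm (x1 - x2); set w := frob_norm v => le1 le2 le3.
have : 0 <= mu^-1 * (w - mu / 2 * d) ^+ 2.
  by rewrite mulr_ge0 ?sqr_ge0// invr_ge0 ltW.
have -> : mu^-1 * (w - mu / 2 * d) ^+ 2 = mu^-1 * w ^+ 2 - d * w + mu / 4 * d ^+ 2.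
  by field; rewrite gt_eqF.
lra.
Qed.

(** Along a line the difference quotients of the convex function [vconj phi]
    are nondecreasing, so the supremum of the left ones separates them from the
    right ones. *)
Lemma vconj_subgradient_line y e :
  exists c, forall s, vconj phi y + c * s <= vconj phi (y + s *: e).
Proof.
pose F s := vconj phi (y + s *: e).
have F0 : F 0 = vconj phi y by rewrite /F scale0r addr0.
have slopes s s' : 0 < s -> 0 < s' -> (F 0 - F (- s)) / s <= (F s' - F 0) / s'.
  move=> s0 s'0; have ss0 : 0 < s + s' by rewrite addr_gt0.
  pose a := s' / (s + s'); pose b := s / (s + s').
  have a0 : 0 <= a by rewrite divr_ge0 ?ltW.
  have b0 : 0 <= b by rewrite divr_ge0 ?ltW.
  have ab1 : a + b = 1 by rewrite -mulrDl addrC divff ?gt_eqF.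
  have abE : a * s = b * s' by rewrite /a /b mulrAC [RHS]mulrAC (mulrC s').
  have := vconj_convex (y - s *: e) (y + s' *: e) a0 b0 ab1.
  have -> : a *: (y - s *: e) + b *: (y + s' *: e) = y.
    rewrite !scalerDr addrACA -scalerDl ab1 scale1r scalerN !scalerA abE.
    by rewrite addNr addr0.
  rewrite -F0 -scaleNr -!/(F _) => conv.
  have : (s + s') * F 0 <= s' * F (- s) + s * F s'.
    have s'E : (s + s') * a = s' by rewrite mulrC divfK ?gt_eqF.
    have sE : (s + s') * b = s by rewrite mulrC divfK ?gt_eqF.
    have -> : s' * F (- s) = (s + s') * (a * F (- s)) by rewrite mulrA s'E.
    have -> : s * F s' = (s + s') * (b * F s') by rewrite mulrA sE.
    by rewrite -mulrDr ler_pM2l.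
  rewrite ler_pdivrMr// mulrAC ler_pdivlMr//; lra.
pose S := [set (F 0 - F (- s)) / s | s in [set s | 0 < s]].
have S0 : S !=set0 by exists ((F 0 - F (- 1)) / 1); exists 1 => //=; exact: ltr01.
have Sub s' : 0 < s' -> ubound S ((F s' - F 0) / s').
  by move=> s'0 _ [s s0 <-]; exact: slopes.
exists (sup S) => s; rewrite -F0 -/(F s).
have [s0|s0|->] := ltgtP s 0; last by rewrite mulr0 addr0.
- have Ns0 : 0 < - s by rewrite oppr_gt0.
  have : (F 0 - F (- - s)) / - s <= sup S.
    apply: ub_le_sup; last by exists (- s).
    by exists ((F 1 - F 0) / 1); apply: Sub; exact: ltr01.
  by rewrite ler_pdivrMr// opprK; lra.
- by have := ge_sup S0 (Sub _ s0); rewrite ler_pdivlMr//; lra.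
Qed.


(** * Conjugates of isotropic reference functions *)

Definition radial_slope (g : R -> \bar R) (t : R) : R :=
  ((sconj g)^`())%classic t / t.

Context (h : R -> \bar R) (h_ge0 : forall t, (0 <= h t)%E).
Context (phiE : forall x, phi x = h (frob_norm x)).

(** For [t > 0] the left-hand side is the value at [y] of the affine function
    attached to a vector of norm [t] aligned with [y]; for [t <= 0] it is at
    most zero because [h] is nonnegative. *)
Lemma kernel_le_vconj y t r : h t = r%:E -> t * frob_norm y - r <= vconj phi y.
Proof.
move=> htr; have r0 : 0 <= r by rewrite -lee_fin -htr.
have [ty|ty] := ltP 0 (t * frob_norm y); last first.
  by rewrite (le_trans _ (vconj_ge0 y))// subr_le0 (le_trans ty).
have y0 : 0 < frob_norm y.
  rewrite lt0r frob_norm_ge0 andbT; apply: contraTneq ty => ->.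
  by rewrite mulr0 ltxx.
have t0 : 0 < t by rewrite -(pmulr_lgt0 _ y0).
pose x := (t / frob_norm y) *: y.
have xt : frob_norm x = t.
  by rewrite frob_normZ ger0_norm ?divr_ge0 ?ltW// divfK ?gt_eqF.
have := @vconj_ge x y r; rewrite phiE xt => /(_ htr).
by rewrite dotZl dotxx expr2 mulrA divfK ?gt_eqF.
Qed.

Lemma sconj_frob_norm y : sconj h (frob_norm y) = vconj phi y.
Proof.
have h_proper : proper_fun h.
  split=> [t|]; first by rewrite gt_eqF// (lt_le_trans _ (h_ge0 t)).
  by exists (frob_norm (0 : 'rV[R]_N)); rewrite /edom/= -phiE phi0.
have [ub lub] := fine_conjugate (ip := *%R) h_proper (@kernel_le_vconj y).
apply/eqP; rewrite eq_le; apply/andP; split; first exact/lub/kernel_le_vconj.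
apply: vconj_le => x r; rewrite phiE => /ub; apply: le_trans.
by rewrite lerB// dot_le.
Qed.

Lemma le_vconj y z : frob_norm y <= frob_norm z -> vconj phi y <= vconj phi z.
Proof.
move=> yz; apply: vconj_le => x r; rewrite phiE => xE.
apply: le_trans (kernel_le_vconj z xE); rewrite lerB//.
by rewrite (le_trans (dot_le _ _))// ler_wpM2l// frob_norm_ge0.
Qed.

Lemma vconj_0 : vconj phi 0 = 0.
Proof.
apply/eqP; rewrite eq_le vconj_ge0 (le_trans (vconj_le_sqr _))//.
by rewrite frob_norm0 expr0n mulr0.
Qed.

Let slope := radial_slope h.

(** The subgradient along the ray through [y] is a subgradient in every
    direction because [vconj phi] is radially nondecreasing; the bound on second
    differences then leaves no room for another one, so it is the gradient. *)
Lemma vconj_subgradient_quadratic y : y != 0 -> exists c, forall v,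
  0 <= vconj phi (y + v) - vconj phi y - c * dot y v
    <= mu^-1 * frob_norm v ^+ 2.
Proof.
move=> /frob_norm_gt0 y0; have y20 : 0 < frob_norm y ^+ 2 by rewrite exprn_gt0.
have [c cP] := vconj_subgradient_line y y.
exists (c / frob_norm y ^+ 2).
have lb v : 0 <= vconj phi (y + v) - vconj phi y - c / frob_norm y ^+ 2 * dot y v.
  pose s := dot y v / frob_norm y ^+ 2.
  have /le_vconj : frob_norm (y + s *: y) <= frob_norm (y + v).
    rewrite -{1}[y]scale1r -scalerDl frob_normZ -(ler_pM2r y0) -mulrA -expr2.
    rewrite -(ger0_norm (ltW y20)) -normrM mulrDl mul1r divfK ?gt_eqF//.
    by rewrite -dotxx -dotDr mulrC norm_dot_le.
  have := cP s; have -> : c / frob_norm y ^+ 2 * dot y v = c * s.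
    by rewrite /s mulrAC mulrA.
  lra.
move=> v; rewrite lb/=; have := lb (- v); have := vconj_second_difference y v.
rewrite dotNr; lra.
Qed.

Lemma is_derive_sconj y (c : R) : y != 0 ->
  (forall v, 0 <= vconj phi (y + v) - vconj phi y - c * dot y v
    <= mu^-1 * frob_norm v ^+ 2) ->
  is_derive (frob_norm y) (1 : R) (sconj h) (c * frob_norm y).
Proof.
move=> /frob_norm_gt0 y0 cP; apply: (@is_derive_quadratic _ _ _ _ _ _ mu^-1).
near=> s.
have sy : 0 < frob_norm y + s.
  have : `|s| < frob_norm y by near: s; exact: dnbhs0_lt.
  by rewrite ltr_norml => /andP[+ _]; lra.
have -> : s *: 1 + frob_norm y = frob_norm (y + (s / frob_norm y) *: y).
  have -> : y + (s / frob_norm y) *: y = ((frob_norm y + s) / frob_norm y) *: y.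
    by rewrite mulrDl divff ?gt_eqF// scalerDl scale1r.
  rewrite frob_normZ normrM normfV !gtr0_norm// divfK ?gt_eqF//.
  by rewrite addrC /GRing.scale/= mulr1.
rewrite !sconj_frob_norm; have := cP ((s / frob_norm y) *: y).
rewrite dotZr dotxx frob_normZ normrM normfV (ger0_norm (ltW y0)).
have yK := divfK (lt0r_neq0 y0).
rewrite yK real_normK ?num_real// expr2 [s / _ * _]mulrA yK.
rewrite mulrCA => /andP[c0 c1].
by rewrite ger0_norm.
Unshelve. all: by end_near. Qed.

Lemma vconj_quadratic y v : y != 0 ->
  0 <= vconj phi (y + v) - vconj phi y - slope (frob_norm y) * dot y v
    <= mu^-1 * frob_norm v ^+ 2.
Proof.
move=> y0; have [c cP] := vconj_subgradient_quadratic y0.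
suff -> : slope (frob_norm y) = c by [].
rewrite /slope /radial_slope derive1E (@derive_val _ _ _ _ _ _ _ (is_derive_sconj y0 cP)).
by rewrite mulfK// gt_eqF// frob_norm_gt0.
Qed.

Lemma gradient_vconj y : gradient (vconj phi) y = slope (frob_norm y) *: y.
Proof.
apply: (@gradient_quadratic _ _ _ _ _ mu^-1) => v.
have [->|y0] := eqVneq y 0; last first.
  by rewrite dotZl; have /andP[c0 c1] := vconj_quadratic v y0; rewrite ger0_norm.
rewrite scaler0 dotC dot0r add0r vconj_0 !subr0 ger0_norm ?vconj_ge0//.
rewrite (le_trans (vconj_le_sqr v))// ler_wpM2r ?sqr_ge0//.
have : 0 < mu^-1 by rewrite invr_gt0.
rewrite invfM; lra.
Qed.

(** The tangent at [y] is tested at the origin, where [vconj phi] attains its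
    minimum, and at [2 *: y], against the quadratic upper bound on
    [vconj phi]. *)
Lemma slope_bounds (y : 'rV[R]_N) : y != 0 -> 0 <= slope (frob_norm y) <= 2 / mu.
Proof.
move=> y0; have yn0 := frob_norm_gt0 y0.
have y20 : 0 < frob_norm y ^+ 2 by rewrite exprn_gt0.
have /andP[le1 _] := vconj_quadratic (- y) y0.
have /andP[le2 _] := vconj_quadratic y y0.
move: le1 le2; rewrite subrr vconj_0 dotNr dotxx => le1 le2.
have yge0 := vconj_ge0 y.
have := vconj_le_sqr (y + y).
rewrite -mulr2n -scaler_nat frob_normZ exprMn real_normK ?num_real// => le3.
rewrite -(ler_pM2r y20) -(ler_pM2r y20 _ (2 / mu)) mul0r.
have E : (2 * mu)^-1 * (2 ^+ 2 * frob_norm y ^+ 2) = 2 / mu * frob_norm y ^+ 2.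
  by field; rewrite gt_eqF.
by apply/andP; split; move: le2 le3; rewrite -mulr2n -scaler_nat E; lra.
Qed.

(** The quantity [slope t * t] is the derivative of the kernel conjugate, which is
    nondecreasing by convexity: the tangents at [|y|] and [|z|] are compared
    along one ray. *)
Lemma slope_mul_le (y z : 'rV[R]_N) : y != 0 -> frob_norm y <= frob_norm z ->
  slope (frob_norm y) * frob_norm y <= slope (frob_norm z) * frob_norm z.
Proof.
move=> y0; rewrite le_eqVlt => /predU1P[->//|yz].
have yn0 := frob_norm_gt0 y0; have zn0 := lt_trans yn0 yz.
have z0 : z != 0 by apply: contraTneq zn0 => ->; rewrite frob_norm0 ltxx.
have step u w : u != 0 -> 0 < frob_norm w ->
    slope (frob_norm u) * frob_norm u * (frob_norm w - frob_norm u)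
      <= vconj phi w - vconj phi u.
  move=> u0 wn0; have un0 := frob_norm_gt0 u0.
  have /andP[+ _] := vconj_quadratic ((frob_norm w / frob_norm u - 1) *: u) u0.
  have -> : vconj phi (u + (frob_norm w / frob_norm u - 1) *: u) = vconj phi w.
    rewrite -!sconj_frob_norm -{1}[u]scale1r -scalerDl addrC subrK frob_normZ.
    by rewrite normrM normfV !ger0_norm ?frob_norm_ge0// divfK// gt_eqF.
  have -> : dot u ((frob_norm w / frob_norm u - 1) *: u) =
      frob_norm u * (frob_norm w - frob_norm u).
    by rewrite dotZr dotxx expr2 mulrA mulrBl mul1r divfK ?gt_eqF// mulrC.
  by rewrite mulrA subr_ge0.
have := step y z y0 zn0; have := step z y z0 yn0 => le1 le2.
by rewrite -(ler_pM2r (_ : 0 < frob_norm z - frob_norm y)) ?subr_gt0//; lra.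
Qed.

Context (slope_noninc : forall t u : R, 0 < t -> t <= u -> slope u <= slope t).

(** The radial field [y |-> slope |y| *: y] is Lipschitz with constant its scalar
    factor at the point nearer to the origin, because [slope] decreases while
    [slope t * t], the derivative of the convex kernel conjugate, increases. *)
Lemma gradient_vconj_lipschitz (y z : 'rV[R]_N) (rho : R) : 0 < rho ->
  rho <= frob_norm y -> rho <= frob_norm z ->
  frob_norm (gradient (vconj phi) z - gradient (vconj phi) y)
    <= slope rho * frob_norm (z - y).
Proof.
move=> rho0.
wlog yz : y z / frob_norm y <= frob_norm z => [wlg rhoy rhoz|rhoy _].
  have [yz|/ltW zy] := leP (frob_norm y) (frob_norm z); first exact: wlg.
  have frobB (u w : 'rV[R]_N) : frob_norm (u - w) = frob_norm (w - u).
    by rewrite -opprB -scaleN1r frob_normZ normrN1 mul1r.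
  by rewrite frobB (frobB z); exact: wlg.
have yn0 := lt_le_trans rho0 rhoy; have zn0 := lt_le_trans yn0 yz.
have neq0 (u : 'rV[R]_N) : 0 < frob_norm u -> u != 0.
  by move=> u0; apply: contraTneq u0 => ->; rewrite frob_norm0 ltxx.
rewrite !gradient_vconj.
apply: (@le_trans _ _ (slope (frob_norm y) * frob_norm (z - y))); last first.
  by rewrite ler_wpM2r ?frob_norm_ge0// slope_noninc.
have := slope_mul_le (neq0 _ yn0) yz; have := slope_noninc yn0 yz.
have /andP[+ _] := slope_bounds (neq0 _ zn0); have := dot_le y z.
set a := slope (frob_norm y); set b := slope (frob_norm z) => dyz b0 ba abyz.
have a0 := le_trans b0 ba.
apply: le_frob_norm; first by rewrite mulr_ge0 ?frob_norm_ge0.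
(* Expanding the squares, the claim is that the product of [a - b] and
   [(a + b) * |z| ^+ 2 - 2 * a * dot y z] is nonnegative. *)
rewrite exprMn -!dotxx !dotDl !dotDr !dotNl !dotNr !dotZl !dotZr (dotC z) !dotxx.
move: (frob_norm y) (frob_norm z) (dot y z) => p q d in yz yn0 zn0 dyz abyz *.
have ad : a * d <= b * q ^+ 2.
  by rewrite (le_trans (ler_wpM2l a0 dyz))// mulrA expr2 mulrA ler_wpM2r// ltW.
have := mulr_ge0 (_ : 0 <= a - b) (_ : 0 <= (a + b) * q ^+ 2 - 2 * (a * d)).
rewrite !subr_ge0 => /(_ ba) -/(_ _) key.
have /key : 2 * (a * d) <= (a + b) * q ^+ 2.
  have := ler_wpM2r (sqr_ge0 q) ba; lra.
nra.
Qed.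

(** Any radius smaller than [|y|] would do in place of [|y| / 2]: it bounds from
    below the norms of all points near [y]. *)
Lemma vconj_hessian_le_slope (y v : 'rV[R]_N) : y != 0 ->
  frob_norm (v *m hessian (vconj phi) y)
    <= slope (frob_norm y / 2) * frob_norm v.
Proof.
move=> y0; have yn0 := frob_norm_gt0 y0.
have y2 : frob_norm (2^-1 *: y) = frob_norm y / 2.
  by rewrite frob_normZ gtr0_norm ?invr_gt0// mulrC.
have y20 : 2^-1 *: y != 0 by rewrite scaler_eq0 invr_eq0 pnatr_eq0.
apply: frob_norm_mul_hessian_le.
  by rewrite -y2; have /andP[] := slope_bounds y20.
have yhalf : frob_norm y / 2 < frob_norm y by lra.
have cont : frob_norm (s *: v + y) @[s --> (0 : R)] --> frob_norm y.
  rewrite -{2}[y]add0r -[in X in _ --> X](scale0r v).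
  apply: (@continuous_comp _ _ _ (fun s : R => s *: v + y)); last first.
    exact: frob_norm_continuous.
  by apply: cvgD; [exact: scalel_continuous | exact: cvg_cst].
near=> s; rewrite -frob_normZ -[s *: v in leRHS](addrK y).
apply: gradient_vconj_lipschitz; rewrite ?divr_gt0// ltW//.
by near: s; apply: nbhs_dnbhs; exact: (cvgr_gt _ cont).
Unshelve. all: by end_near. Qed.

Lemma vconj_hessian_le (y v : 'rV[R]_N) :
  frob_norm (v *m hessian (vconj phi) y) <= 2 / mu * frob_norm v.
Proof.
have [->|y0] := eqVneq y 0; last first.
  rewrite (le_trans (vconj_hessian_le_slope v y0))//.
  rewrite ler_wpM2r ?frob_norm_ge0//.
  have y20 : 2^-1 *: y != 0 by rewrite scaler_eq0 invr_eq0 pnatr_eq0.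
  have := slope_bounds y20.
  by rewrite frob_normZ gtr0_norm ?invr_gt0// mulrC => /andP[].
have mu2 : 0 <= 2 / mu by rewrite divr_ge0 ?ltW.
apply: frob_norm_mul_hessian_le => //; near=> s.
rewrite !gradient_vconj scaler0 subr0 addr0 -frob_normZ.
have [->|sv0] := eqVneq (s *: v) 0; first by rewrite scaler0 frob_norm0 mulr0.
have /andP[ge0 le2] := slope_bounds sv0.
by rewrite frob_normZ ger0_norm// ler_wpM2r// frob_norm_ge0.
Unshelve. all: by end_near. Qed.
End strongly_convex_conjugate.

(** * Polynomial functions and their derivatives *)

Section polynomial_functions.
Context {R : realType} {N : nat}.
Implicit Types (p q : 'rV[R]_N -> R) (x v : 'rV[R]_N).

(** The index is an upper bound on the degree, not the degree itself: no function
    has to be shown nonzero, and growth, differentiability and closure under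
    derivation are one induction each. *)
Inductive polyfun : nat -> ('rV[R]_N -> R) -> Prop :=
| polyfun_cst d c : polyfun d (fun=> c)
| polyfunD d p q : polyfun d p -> polyfun d q -> polyfun d (fun x => p x + q x)
| polyfun_coordM d i p : polyfun d p -> polyfun d.+1 (fun x => x 0 i * p x).

Lemma polyfun_le d e p : (d <= e)%N -> polyfun d p -> polyfun e p.
Proof.
move=> + pd; elim: pd e => {d p}[d c|d p q _ IHp _ IHq|d i p _ IHp] e.
- by move=> _; exact: polyfun_cst.
- by move=> de; apply: polyfunD; [exact: IHp | exact: IHq].
- by case: e => // e de; apply: polyfun_coordM; exact: IHp.
Qed.

Lemma polyfun_coord i : polyfun 1 (fun x => x 0 i).
Proof.
rewrite (_ : (fun x => _) = fun x => x 0 i * 1); last first.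
  by apply/funext => x; rewrite mulr1.
by apply: polyfun_coordM; exact: polyfun_cst.
Qed.

Lemma polyfunZ d c p : polyfun d p -> polyfun d (fun x => c * p x).
Proof.
elim=> {d p}[d a|d p q _ IHp _ IHq|d i p _ IHp].
- exact: polyfun_cst.
- under eq_fun do rewrite mulrDr.
  exact: polyfunD.
- under eq_fun do rewrite mulrCA.
  exact: polyfun_coordM.
Qed.

Lemma polyfunM d e p q : polyfun d p -> polyfun e q ->
  polyfun (d + e) (fun x => p x * q x).
Proof.
move=> + qe; elim=> {d p}[d c|d p p' _ IHp _ IHp'|d i p _ IHp].
- by apply: (polyfun_le (leq_addl d e)); exact: polyfunZ.
- under eq_fun do rewrite mulrDl.
  exact: polyfunD.
- under eq_fun do rewrite -mulrA.
  exact: polyfun_coordM.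
Qed.

Lemma polyfun_sum d n (F : 'I_n -> 'rV[R]_N -> R) :
  (forall k, polyfun d (F k)) -> polyfun d (fun x => \sum_k F k x).
Proof.
move=> Fd; elim: n F Fd => [|n IHn] F Fd.
  under eq_fun do rewrite big_ord0.
  exact: polyfun_cst.
under eq_fun do rewrite big_ord_recl.
by apply: polyfunD => //; exact: IHn.
Qed.

Lemma polyfun_growth d p : polyfun d p ->
  exists2 C : R, 0 <= C & forall x, `|p x| <= C * (1 + frob_norm x) ^+ d.
Proof.
have ge1 x : 1 <= 1 + frob_norm x by rewrite lerDl frob_norm_ge0.
have ge0 x k : 0 <= (1 + frob_norm x) ^+ k.
  by rewrite exprn_ge0// (le_trans _ (ge1 x)).
elim=> {d p}[d c|d p q _ [C C0 pC] _ [D D0 qD]|d i p _ [C C0 pC]].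
- by exists `|c| => // x; rewrite ler_peMr// exprn_ege1.
- exists (C + D) => [|x]; first exact: addr_ge0.
  by rewrite (le_trans (ler_normD _ _))// mulrDl lerD.
- exists C => // x; rewrite normrM exprS mulrCA ler_pM//.
  by rewrite (le_trans (norm_entry_le x 0 i))// lerDr.
Qed.

Lemma polyfun_differentiable d p : polyfun d p -> forall x, differentiable p x.
Proof.
elim=> {d p}[d c|d p q _ IHp _ IHq|d i p _ IHp] x.
- exact: differentiable_cst.
- exact: differentiableD.
- by apply: differentiableM => //; exact: differentiable_coord.
Qed.

Lemma polyfun_continuous d p : polyfun d p -> continuous p.
Proof.
by move=> pd x; apply: differentiable_continuous; exact: polyfun_differentiable pd x.
Qed.

Lemma polyfun_derive d p v : polyfun d.+1 p -> polyfun d (fun x => 'D_v p x).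
Proof.
(* At [e = 0] the bound [e.-1] loses nothing; the product rule then needs that
   the derivative vanishes. *)
suff H e q : polyfun e q ->
    polyfun e.-1 (fun x => 'D_v q x) /\ (e = 0%N -> forall x, 'D_v q x = 0).
  by move=> /H[].
elim=> {e q}[e c|e q s qe [IHq IHq0] se [IHs IHs0]|e i q qe [IHq IHq0]].
- under eq_fun do rewrite derive_cst.
  by split=> [|_ x]; [exact: polyfun_cst | exact: derive_cst].
- have dE x : 'D_v (fun y => q y + s y) x = 'D_v q x + 'D_v s x.
    apply: deriveD; apply: diff_derivable.
      exact: polyfun_differentiable qe _.
    exact: polyfun_differentiable se _.
  under eq_fun do rewrite dE.
  by split=> [|e0 x]; [exact: polyfunD | rewrite dE IHq0// IHs0// addr0].
- have dE x : 'D_v (fun y : 'rV[R]_N => y 0 i * q y) x =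
      v 0 i * q x + x 0 i * 'D_v q x.
    rewrite [LHS](@deriveM _ _ (fun y : 'rV[R]_N => y 0 i) q); last 2 first.
    + by apply: diff_derivable; exact: differentiable_coord.
    + by apply: diff_derivable; exact: polyfun_differentiable qe _.
    have /matrixP/(_ 0 i) := derive_mx (@derivable_id _ _ x v).
    by rewrite derive_id mxE => <-; rewrite addrC [X in X + _]mulrC.
  split=> //; under eq_fun do rewrite dE.
  apply: polyfunD; first exact: polyfunZ.
  case: e qe IHq IHq0 => [|e] _ IHq IHq0 /=; last exact: polyfun_coordM.
  under eq_fun do rewrite IHq0// mulr0.
  exact: polyfun_cst.
Qed.

Lemma gradientE p x : gradient p x = \sum_i 'D_(delta_mx 0 i) p x *: delta_mx 0 i.
Proof.
by rewrite [LHS]row_sum_delta; apply: eq_bigr => i _; rewrite mxE.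
Qed.

Lemma derive_dot_gradient p x v : differentiable p x ->
  'D_v p x = dot (gradient p x) v.
Proof.
move=> px; rewrite deriveE// [in LHS](row_sum_delta v) linear_sum.
by apply: eq_bigr => i _; rewrite linearZ mxE deriveE//= mulrC.
Qed.

Lemma polyfun_gradient_differentiable d p x : polyfun d.+1 p ->
  differentiable (gradient p) x.
Proof.
move=> pd; rewrite (_ : gradient p =
  \sum_i (fun x => 'D_(delta_mx 0 i) p x *: (delta_mx 0 i : 'rV[R]_N))); last first.
  by apply/funext => y; rewrite fct_sumE gradientE.
apply: differentiable_sum => i; apply: differentiableZl.
exact: (polyfun_differentiable (polyfun_derive _ pd)).
Qed.

Lemma hessianE d p x : polyfun d.+1 p ->
  hessian p x = \matrix_(j, i) 'D_(delta_mx 0 j) (fun y => 'D_(delta_mx 0 i) p y) x.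
Proof.
move=> pd; apply/row_matrixP => j; rewrite rowE /hessian -deriveEjacobian; last first.
  exact: polyfun_gradient_differentiable pd.
rewrite derive_mx; last first.
  exact/diff_derivable/polyfun_gradient_differentiable/pd.
apply/rowP => i; rewrite !mxE; congr ('D_ _ _ x).
by apply/funext => y; rewrite mxE.
Qed.

Lemma polyfun_C2 d p : polyfun d.+2 p -> C2_on setT p.
Proof.
move=> pd x _; split.
- exact: polyfun_differentiable pd _.
- exact: polyfun_gradient_differentiable pd.
have -> : hessian p = fun x => \sum_j \sum_i
    'D_(delta_mx 0 j) (fun y => 'D_(delta_mx 0 i) p y) x *: delta_mx j i.
  apply/funext => y; rewrite (hessianE _ pd) [LHS]matrix_sum_delta.
  by apply: eq_bigr => j _; apply: eq_bigr => i _; rewrite mxE.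
have entry j i : continuous (fun y : 'rV[R]_N =>
    'D_(delta_mx 0 j) (fun z => 'D_(delta_mx 0 i) p z) y *: (delta_mx j i : 'M[R]_N)).
  move=> y; apply: cvgZr_tmp; first exact: nbhs_filter.
  exact: (@polyfun_continuous d _ (polyfun_derive _ (polyfun_derive _ pd)) y).
move: x; apply: continuous_big => [|j _]; first exact: add_continuous.
by apply: continuous_big => [|i _]; [exact: add_continuous | exact: entry].
Qed.

Lemma polyfun_hessian_growth d p : polyfun d.+2 p ->
  exists2 C : R, 0 <= C &
    forall x, frob_norm (hessian p x) <= C * (1 + frob_norm x) ^+ d.
Proof.
move=> pd.
have /fin_all_exists[C CP] (ji : 'I_N * 'I_N) : exists C : R, 0 <= C /\ forall x,
    `|'D_(delta_mx 0 ji.1) (fun y => 'D_(delta_mx 0 ji.2) p y) x|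
      <= C * (1 + frob_norm x) ^+ d.
  have [|C C0 CP] := @polyfun_growth d
      (fun x => 'D_(delta_mx 0 ji.1) (fun y => 'D_(delta_mx 0 ji.2) p y) x).
    by apply: polyfun_derive; exact: polyfun_derive.
  by exists C.
have CS ji : C ji <= \sum_k C k.
  by rewrite (bigD1 ji)//= lerDl sumr_ge0// => k _; have [] := CP k.
have S0 : 0 <= \sum_k C k by rewrite sumr_ge0// => k _; have [] := CP k.
exists (Num.sqrt (N * N)%:R * \sum_k C k) => [|x].
  by rewrite mulr_ge0 ?sqrtr_ge0.
have ge0 : 0 <= (1 + frob_norm x) ^+ d by rewrite exprn_ge0// addr_ge0// frob_norm_ge0.
rewrite -mulrA; apply: frob_norm_le_entries; first exact: mulr_ge0.
move=> j i; rewrite (hessianE _ pd) mxE.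
by rewrite (le_trans ((CP (j, i)).2 x))// ler_wpM2r.
Qed.

End polynomial_functions.

(** * The matrix factorization objective *)

Section matrix_inner_product.
Context {R : realType} {m n : nat}.
Implicit Types (A B : 'M[R]_(m, n)).

Definition mxdot A B : R := \sum_i \sum_j A i j * B i j.

Lemma sqr_frob_normB A B :
  frob_norm (A - B) ^+ 2 = frob_norm A ^+ 2 - 2 * mxdot A B + frob_norm B ^+ 2.
Proof.
rewrite !sqr_frob_norm mulr_sumr -sumrB -big_split; apply: eq_bigr => i _.
rewrite mulr_sumr -sumrB -big_split; apply: eq_bigr => j _.
by rewrite !mxE/=; ring.
Qed.

Lemma mxdotZl c A B : mxdot (c *: A) B = c * mxdot A B.
Proof.
rewrite mulr_sumr; apply: eq_bigr => i _; rewrite mulr_sumr.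
by apply: eq_bigr => j _; rewrite mxE mulrA.
Qed.

Lemma mxdot_le A B :
  2 * mxdot A B <= 2 * frob_norm A ^+ 2 + frob_norm B ^+ 2 / 2.
Proof.
have := sqr_ge0 (frob_norm (2 *: A - B)); rewrite sqr_frob_normB mxdotZl.
by rewrite frob_normZ exprMn real_normK ?num_real//; lra.
Qed.

Lemma sqr_frob_norm_vec_mx (v : 'rV[R]_(m * n)) :
  frob_norm (vec_mx v : 'M[R]_(m, n)) ^+ 2 = frob_norm v ^+ 2.
Proof.
rewrite !sqr_frob_norm big_ord1 pair_big/=.
rewrite [RHS](reindex _ (curry_mxvec_bij _ _))/=.
by apply: eq_bigr => -[i j] _; rewrite mxE.
Qed.

Lemma polyfun_sqr_frob_norm N d (M : 'rV[R]_N -> 'M[R]_(m, n)) :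
  (forall i j, polyfun d (fun x => M x i j)) ->
  polyfun (d + d) (fun x => frob_norm (M x) ^+ 2).
Proof.
move=> Md; under eq_fun do rewrite sqr_frob_norm.
apply: polyfun_sum => i; apply: polyfun_sum => j.
under eq_fun do rewrite expr2.
exact: polyfunM.
Qed.

End matrix_inner_product.

Section objective.
Context {R : realType} {m n r : nat} (Y : 'M[R]_(m, n)) (kappa : R).
Context (kappa_gt0 : 0 < kappa).
Let f := mf_objective_vec r Y kappa.
Let Wpart (x : 'rV[R]_(m * r + r * n)) : 'M[R]_(m, r) := vec_mx (lsubmx x).
Let Hpart (x : 'rV[R]_(m * r + r * n)) : 'M[R]_(r, n) := vec_mx (rsubmx x).

Lemma mf_objective_polyfun : polyfun 4 f.
Proof.
have Wd i k : polyfun 1 (fun x => Wpart x i k).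
  under eq_fun do rewrite !mxE.
  exact: polyfun_coord.
have Hd k j : polyfun 1 (fun x => Hpart x k j).
  under eq_fun do rewrite !mxE.
  exact: polyfun_coord.
have quartic (k l : nat) (M : 'rV[R]_(m * r + r * n) -> 'M[R]_(k, l)) :
    (forall i j, polyfun 1 (fun x => M x i j)) ->
    polyfun 4 (fun x => kappa / 4 * frob_norm (M x) ^+ 4).
  move=> /polyfun_sqr_frob_norm M2; apply: polyfunZ.
  under eq_fun do rewrite (exprD _ 2 2).
  exact: (polyfunM M2 M2).
apply: polyfunD; last exact: quartic.
apply: polyfunD; last exact: quartic.
apply: polyfunZ; apply: (@polyfun_sqr_frob_norm _ _ _ _ 2) => i j.
under eq_fun do rewrite 3!mxE.
apply: polyfunD; last exact: polyfun_cst.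
apply: polyfun_sum => k; exact: (@polyfunM _ _ 1 1).
Qed.

Lemma sqr_frob_norm_parts x :
  frob_norm x ^+ 2 = frob_norm (Wpart x) ^+ 2 + frob_norm (Hpart x) ^+ 2.
Proof.
rewrite !sqr_frob_norm_vec_mx !sqr_frob_norm !big_ord1 big_split_ord/=.
by congr (_ + _); apply: eq_bigr => i _; rewrite mxE.
Qed.

(** Euler's identity, read off from the polynomial [s |-> f ((1 + s) *: x)]. *)
Lemma dot_gradient_mf_objective x : dot (gradient f x) x =
  2 * frob_norm (Wpart x *m Hpart x) ^+ 2 - 2 * mxdot (Wpart x *m Hpart x) Y
  + kappa * (frob_norm (Wpart x) ^+ 4 + frob_norm (Hpart x) ^+ 4).
Proof.
rewrite -derive_dot_gradient; last exact: polyfun_differentiable mf_objective_polyfun _.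
set W := Wpart x; set H := Hpart x.
pose A := frob_norm (W *m H) ^+ 2 / 2
  + kappa / 4 * (frob_norm W ^+ 4 + frob_norm H ^+ 4).
pose B := mxdot (W *m H) Y.
have fE s : f (s *: x + x) =
    A * (1 + s) ^+ 4 - B * (1 + s) ^+ 2 + frob_norm Y ^+ 2 / 2.
  have -> : s *: x + x = (1 + s) *: x by rewrite addrC scalerDl scale1r.
  have WE : Wpart ((1 + s) *: x) = (1 + s) *: W by rewrite /W /Wpart !linearZ.
  have HE : Hpart ((1 + s) *: x) = (1 + s) *: H by rewrite /H /Hpart !linearZ.
  have even k : `|1 + s| ^+ (2 * k) = (1 + s) ^+ (2 * k).
    by rewrite exprM real_normK ?num_real// -exprM.
  rewrite /f /mf_objective_vec /mf_objective -/(Wpart _) -/(Hpart _) WE HE.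
  rewrite -scalemxAl -scalemxAr scalerA -expr2 sqr_frob_normB mxdotZl -/B.
  by rewrite !frob_normZ normrX !exprMn (even 2) (even 1) /A; field.
have f0 : f x = A - B + frob_norm Y ^+ 2 / 2.
  by have := fE 0; rewrite scale0r add0r addr0 !expr1n !mulr1.
have -> : 2 * frob_norm (W *m H) ^+ 2 - 2 * B
  + kappa * (frob_norm W ^+ 4 + frob_norm H ^+ 4) = 4 * A - 2 * B.
  by rewrite /A; field.
suff /@derive_val -> : is_derive x x f (4 * A - 2 * B) by [].
(* For [|s| <= 1] the remainder [(A * (6 + 4 * s + s ^+ 2) - B) * s ^+ 2] has a
   coefficient of at most [11 * |A| + |B|]. *)
apply: (@is_derive_quadratic _ _ _ _ _ _ (11 * `|A| + `|B|)).
near=> s.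
have s1 : `|s| <= 1 by near: s; exact: dnbhs0_le.
have -> : f (s *: x + x) - f x - s * (4 * A - 2 * B) =
    (A * (6 + 4 * s + s ^+ 2) - B) * s ^+ 2 by rewrite fE f0; ring.
rewrite normrM [X in _ * X]ger0_norm ?sqr_ge0// ler_wpM2r ?sqr_ge0//.
rewrite (le_trans (ler_normB _ _))// lerD2r normrM mulrC ler_wpM2r//.
move: s1; rewrite ler_norml => /andP[s1 s2].
by rewrite ler_norml; nra.
Unshelve. all: by end_near. Qed.

(** In Euler's identity the regularizer contributes at least
    [kappa / 2 * |x|^4], while the cross term with [Y] is absorbed by
    [2 * |W H|^2] up to the constant [|Y|^2 / 2]; the bound on [|x|] makes this
    constant at most half of the quartic term. *)
Lemma gradient_mf_objective_ge x : 1 + 2 / kappa * frob_norm Y ^+ 2 <= frob_norm x ->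
  kappa / 4 * frob_norm x ^+ 3 <= frob_norm (gradient f x).
Proof.
move=> xY.
have k0 : 0 <= 2 / kappa * frob_norm Y ^+ 2.
  by rewrite mulr_ge0 ?sqr_ge0// divr_ge0// ltW.
have x1 : 1 <= frob_norm x by rewrite (le_trans _ xY)// lerDl.
have x0 : 0 < frob_norm x by exact: lt_le_trans x1.
rewrite -(ler_pM2r x0); apply: le_trans (dot_le _ _).
rewrite dot_gradient_mf_objective.
have := mxdot_le (Wpart x *m Hpart x) Y.
have Yx : frob_norm Y ^+ 2 <= kappa / 2 * frob_norm x ^+ 4.
  apply: (@le_trans _ _ (kappa / 2 * frob_norm x)).
    have := ler_wpM2l (ltW kappa_gt0) xY.
    have -> : kappa * (1 + 2 / kappa * frob_norm Y ^+ 2) =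
      kappa + 2 * frob_norm Y ^+ 2 by field; rewrite gt_eqF.
    by move: kappa_gt0; lra.
  rewrite ler_pM2l ?divr_gt0//.
  by rewrite ler_eXnr.
have quart : frob_norm x ^+ 4 <= 2 * (frob_norm (Wpart x) ^+ 4 + frob_norm (Hpart x) ^+ 4).
  rewrite (_ : 4%N = (2 * 2)%N)// !exprM sqr_frob_norm_parts.
  have := sqr_ge0 (frob_norm (Wpart x) ^+ 2 - frob_norm (Hpart x) ^+ 2).
  by rewrite sqrrB sqrrD; lra.
have := ler_wpM2l (ltW kappa_gt0) quart.
rewrite -[_ / 4 * _ * _]mulrA -exprSr; lra.
Qed.

End objective.

(** * Smoothness of the objective *)

Lemma spectral_norm_le (R : realType) m n (A : 'M[R]_(m, n)) :
  spectral_norm A <= frob_norm A.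
Proof.
apply: ge_sup => [|_ [v /= v1 <-]].
  by exists (frob_norm (A *m (0 : 'cV_n))); exists 0 => //=; rewrite frob_norm0.
by rewrite (le_trans (frob_norm_mulmx _ _))// ler_piMr// frob_norm_ge0.
Qed.

(** Eigenvectors are row vectors here, hence the bound on [v *m A]; an empty
    spectrum is possible over the reals, and its supremum is zero. *)
Lemma lambda_max_mulmx_le (R : realType) N (A B : 'M[R]_N) (K : R) : 0 <= K ->
  (forall v : 'rV[R]_N, frob_norm (v *m A) <= K * frob_norm v) ->
  lambda_max (A *m B) <= K * frob_norm B.
Proof.
move=> K0 AK; rewrite /lambda_max.
have [->|/set0P E0] := eqVneq [set a : R | eigenvalue (A *m B) a] set0.
  by rewrite sup0 mulr_ge0 ?frob_norm_ge0.
apply: ge_sup => // a /= /eigenvalueP[v vE /frob_norm_gt0 v0].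
rewrite -(ler_pM2r v0); apply: (@le_trans _ _ (frob_norm (a *: v))).
  by rewrite frob_normZ ler_pM2r// ler_norm.
rewrite -vE mulmxA (le_trans (frob_norm_mulmx _ _))// mulrAC.
by rewrite ler_wpM2r ?frob_norm_ge0.
Qed.

Section smoothness.
Context {R : realType} {m n r : nat} (Y : 'M[R]_(m, n)) (kappa : R).
Context (kappa_gt0 : 0 < kappa).
Let f := mf_objective_vec r Y kappa.

Lemma mf_objective_L0L1_smooth (L1 : R) : 0 < L1 ->
  exists2 L0 : R, 0 < L0 & L0L1_smooth L0 L1 f.
Proof.
move=> L10; have fpoly := mf_objective_polyfun (r := r) Y kappa.
have [C C0 hessC] := polyfun_hessian_growth fpoly.
(* Beyond [rho] both [4 * C * |x|^2 <= L1 * (kappa / 4 * |x|^3)] and the cubic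
   lower bound on the gradient hold. *)
pose rho := 1 + 2 / kappa * frob_norm Y ^+ 2 + 16 * C / (L1 * kappa).
have Y0 : 0 <= 2 / kappa * frob_norm Y ^+ 2.
  by rewrite mulr_ge0 ?sqr_ge0// divr_ge0// ltW.
have CL0 : 0 <= 16 * C / (L1 * kappa).
  by rewrite divr_ge0 ?mulr_ge0// ltW.
have rho0 : 0 <= rho by rewrite /rho; lra.
have CR0 : 0 <= C * (1 + rho) ^+ 2 by rewrite mulr_ge0 ?sqr_ge0.
exists (C * (1 + rho) ^+ 2 + 1); first by rewrite ltr_wpDl.
split; [lra | exact: ltW | exact: polyfun_C2 fpoly | move=> x].
apply: le_trans (spectral_norm_le _) _; apply: le_trans (hessC x) _.
have x0 := frob_norm_ge0 x; have g0 := frob_norm_ge0 (gradient f x).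
have [xrho|/ltW rhox] := leP (frob_norm x) rho.
  apply: (@le_trans _ _ (C * (1 + rho) ^+ 2)).
    by rewrite ler_wpM2l// ler_sqr ?nnegrE ?addr_ge0// lerD2l.
  by have := mulr_ge0 (ltW L10) g0; lra.
have x1 : 1 <= frob_norm x by move: rhox; rewrite /rho; lra.
have gx : kappa / 4 * frob_norm x ^+ 3 <= frob_norm (gradient f x).
  by apply: gradient_mf_objective_ge => //; move: rhox; rewrite /rho; lra.
have Lx : 16 * C <= L1 * kappa * frob_norm x.
  by rewrite [leRHS]mulrC -ler_pdivrMr ?mulr_gt0//; move: rhox; rewrite /rho; lra.
apply: (@le_trans _ _ (L1 * frob_norm (gradient f x))); last lra.
apply: (@le_trans _ _ (4 * C * frob_norm x ^+ 2)).
  have : (1 + frob_norm x) ^+ 2 <= 4 * frob_norm x ^+ 2 by nra.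
  by move/(ler_wpM2l C0); lra.
have := ler_wpM2l (ltW L10) gx; have := ler_wpM2r (sqr_ge0 (frob_norm x)) Lx.
by rewrite (exprSr _ 2); lra.
Qed.

(** For large [x] the Hessian of [vconj phi] at [Lbar^-1 *: gradient f x] is of order
    [|x|^-2]: the point has norm at least [2 * c * |x|^3], and the growth
    condition on the kernel along the cubic [c * t^3] makes its radial slope at
    [c * |x|^3] smaller than [(c * |x|^2)^-1].  This exactly compensates the
    quadratic growth of the Hessian of [f]. *)
Lemma mf_objective_anisotropic_smooth2 (phi : 'rV[R]_(m * r + r * n) -> \bar R)
    (Lbar : R) : reference_function phi -> condI phi -> 0 < Lbar ->
  exists2 L : R, 0 < L & anisotropic_smooth2 L Lbar phi f.
Proof.
move=> [phi_proper _ [mu mu0 phi_sc] phi_even phi0].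
move=> [h [h_ge0 phiE slope_noninc _ growth]] Lbar0.
have [C C0 hessC] := polyfun_hessian_growth (mf_objective_polyfun (r := r) Y kappa).
(* Half of the factor [kappa / 4] in the lower bound on the gradient, because the
   radial slope will be taken at half of the norm of the gradient. *)
have [c c0 cE] : exists2 c, 0 < c & Lbar * c = kappa / 8.
  exists (kappa / 8 / Lbar); first by rewrite !divr_gt0.
  by rewrite mulrC divfK ?gt_eqF.
have cn0 := lt0r_neq0 c0.
have [M [_ MP]] : \forall y \near +oo, ((sconj h)^`())%classic (c * y ^+ 3) / y < 1.
  near=> y.
  rewrite (_ : c * y ^+ 3 = (c *: 'X^3).[y]); last by rewrite hornerZ hornerXn.
  by near: y; apply: (cvgr_lt _ (growth (c *: 'X^3))); exact: ltr01.
pose rho := 1 + 2 / kappa * frob_norm Y ^+ 2 + `|M|.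
have Y0 : 0 <= 2 / kappa * frob_norm Y ^+ 2.
  by rewrite mulr_ge0 ?sqr_ge0// divr_ge0// ltW.
have rho0 : 0 <= rho by rewrite !addr_ge0.
have mu2 : 0 <= 2 / mu by rewrite divr_ge0// ltW.
pose K1 := 2 / mu * (C * (1 + rho) ^+ 2); pose K2 := 4 * C / c.
have K10 : 0 <= K1 by rewrite mulr_ge0// mulr_ge0// sqr_ge0.
have K20 : 0 <= K2 by rewrite divr_ge0 ?(ltW c0)// mulr_ge0.
have K0 : 0 < K1 + K2 + 1 by rewrite ltr_wpDl// addr_ge0.
exists ((K1 + K2 + 1) / Lbar) => [|x]; first exact: divr_gt0.
rewrite divfK ?gt_eqF//.
set y := Lbar^-1 *: gradient f x; have x0 := frob_norm_ge0 x.
have [xrho|rhox] := leP (frob_norm x) rho.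
  apply: (@le_trans _ _ K1); last lra.
  apply: (@le_trans _ _ (2 / mu * frob_norm (hessian f x))).
    apply: lambda_max_mulmx_le => // v.
    exact: (vconj_hessian_le mu0 phi_proper phi0 phi_even phi_sc h_ge0 phiE slope_noninc).
  rewrite ler_wpM2l// (le_trans (hessC x))// ler_wpM2l//.
  by rewrite ler_sqr ?nnegrE ?addr_ge0// lerD2l.
have M0 := normr_ge0 M.
have x1 : 1 <= frob_norm x by move: rhox; rewrite /rho; lra.
have xM : M < frob_norm x.
  by rewrite (le_lt_trans (ler_norm M))//; move: rhox; rewrite /rho; lra.
have gx : kappa / 4 * frob_norm x ^+ 3 <= frob_norm (gradient f x).
  by apply: gradient_mf_objective_ge => //; move: rhox; rewrite /rho; lra.
have xn0 : 0 < frob_norm x by lra.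
have x20 : 0 < frob_norm x ^+ 2 by rewrite exprn_gt0.
have x30 : 0 < c * frob_norm x ^+ 3 by rewrite mulr_gt0// exprn_gt0.
have yx : c * frob_norm x ^+ 3 <= frob_norm y / 2.
  rewrite frob_normZ gtr0_norm ?invr_gt0// -[leRHS]mulrA ler_pdivlMl//.
  by rewrite mulrA cE; lra.
have y0 : y != 0.
  apply/eqP => y0; move: yx; rewrite y0 frob_norm0; lra.
have slope_le : radial_slope h (frob_norm y / 2) <= (c * frob_norm x ^+ 2)^-1.
  apply: le_trans (slope_noninc _ _ x30 yx) _.
  have := MP _ xM; rewrite ltr_pdivrMr ?mul1r; last lra.
  move=> lt1; rewrite ler_pdivrMr// (le_trans (ltW lt1))//.
  have -> : c * frob_norm x ^+ 3 = c * frob_norm x ^+ 2 * frob_norm x by ring.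
  by rewrite mulKf// mulf_neq0// lt0r_neq0.
apply: (@le_trans _ _ K2); last lra.
apply: (@le_trans _ _ ((c * frob_norm x ^+ 2)^-1 * frob_norm (hessian f x))).
  apply: lambda_max_mulmx_le => [|v].
    by rewrite invr_ge0 mulr_ge0 ?ltW.
  have hv := vconj_hessian_le_slope mu0 phi_proper phi0 phi_even phi_sc h_ge0 phiE
    slope_noninc v y0.
  by rewrite (le_trans hv)// ler_wpM2r// frob_norm_ge0.
rewrite ler_pdivrMl ?mulr_gt0//.
have -> : c * frob_norm x ^+ 2 * K2 = C * (4 * frob_norm x ^+ 2).
  by rewrite /K2; field.
rewrite (le_trans (hessC x))// ler_wpM2l//; nra.
Unshelve. all: by end_near. Qed.

End smoothness.

Theorem theorem2p14 (R : realType) (m n r : nat) (Y : 'M[R]_(m, n))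
    (kappa : R) (kappa_gt0 : 0 < kappa) :
  (forall L1 : R, 0 < L1 ->
     exists2 L0 : R, 0 < L0 & L0L1_smooth L0 L1 (mf_objective_vec r Y kappa))
  /\
  (forall phi : 'rV[R]_(m * r + r * n) -> \bar R,
     reference_function phi -> condS phi -> condI phi ->
     forall Lbar : R, 0 < Lbar ->
     exists2 L : R, 0 < L &
       anisotropic_smooth2 L Lbar phi (mf_objective_vec r Y kappa)).
Proof.
split=> [L1 L10|phi phi_ref _ phiI Lbar Lbar0].
- exact: mf_objective_L0L1_smooth.
- exact: mf_objective_anisotropic_smooth2.
Qed.
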